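(* Let $M$ be a positive integer. If the full set of single-qubit Clifford gates can be implemented on $M$ qubits by permuting the qubits, then there exist two permutation matrices $\mathbf{P}$ and $\mathbf{H}$ of size $2^M\times 2^M$ and complex numbers $z_1,z_2$ of modulus one such that $$\operatorname{rank}\begin{pmatrix} A\\ A'\end{pmatrix}<2^{M+1},$$ where, with $I$ the $2^M\times 2^M$ identity matrix, $$A=\begin{pmatrix}\mathbf{P}-z_1 I & 0\\ 0 & -i\,\mathbf{P}-z_1 I\end{pmatrix},\qquad A'=\begin{pmatrix}\sqrt2\,\mathbf{H}-z_2 I & -z_2 I\\ -z_2 I & \sqrt2\,\mathbf{H}+z_2 I\end{pmatrix}.$$
   Context: The single-qubit Clifford gates are, up to global phase, the 24 elements of the group generated by the Hadamard gate $H=\frac{1}{\sqrt2}\begin{pmatrix}1&1\\1&-1\end{pmatrix}$ and the phase gate $P=\begin{pmatrix}1&0\\0&i\end{pmatrix}$. A permutation of $M$ qubits acts on $(\mathbb{C}^2)^{\otimes M}\cong\mathbb{C}^{2^M}$ by permuting the tensor factors; in the computational basis this is a $2^M\times2^M$ permutation matrix. The full set of single-qubit Clifford gates can be implemented on $M$ qubits by permutations if there is an orthonormal pair of vectors $\mathbf{u},\mathbf{v}\in\mathbb{C}^{2^M}$ (the logical basis states $|0_L\rangle=\mathbf{u}$, $|1_L\rangle=\mathbf{v}$) such that for every single-qubit Clifford gate $G=(G_{ab})_{a,b\in\{0,1\}}$ there are a permutation of the $M$ qubits, with matrix $\mathbf{G}$, and a complex number $z$ of modulus one with $\mathbf{G}\mathbf{u}=z(G_{00}\mathbf{u}+G_{10}\mathbf{v})$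 and $\mathbf{G}\mathbf{v}=z(G_{01}\mathbf{u}+G_{11}\mathbf{v})$. *)

(* Defs.v *)
From HB Require Import structures.
From mathcomp Require Import all_boot all_order all_algebra.
From mathcomp Require Import all_fingroup.
From mathcomp Require Import complex reals.

Set Implicit Arguments.
Unset Strict Implicit.
Unset Printing Implicit Defensive.

Import Order.TTheory GRing.Theory Num.Theory.
Local Open Scope ring_scope.
Local Open Scope sesquilinear_scope.

Section SingleQubit.
Variable C : numClosedFieldType.

Definition mx22 (a b c d : C) : 'M[C]_2 :=
  \matrix_(i, j) if i == 0 then (if j == 0 then a else b)
                 else (if j == 0 then c else d).

Definition hadamard : 'M[C]_2 := (sqrtC 2)^-1 *: mx22 1 1 1 (-1).

Definition phase_gate : 'M[C]_2 := mx22 1 0 0 'i.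

(* Gates are only meant up to a global phase, so every matrix representative of
   each of the 24 gates is included, through the closure under phases. *)
Inductive clifford_gate : 'M[C]_2 -> Prop :=
| clifford_one : clifford_gate 1%:M
| clifford_hadamard : clifford_gate hadamard
| clifford_phase_gate : clifford_gate phase_gate
| clifford_mul G K :
    clifford_gate G -> clifford_gate K -> clifford_gate (G *m K)
| clifford_inv G : clifford_gate G -> clifford_gate (invmx G)
| clifford_global_phase z G :
    `|z| = 1 -> clifford_gate G -> clifford_gate (z *: G).

End SingleQubit.

(* The computational basis vector of index j is
   |b_0> (x) ... (x) |b_(M-1)> with b_k = qubit_bit j k: qubit 0 carries the most
   significant bit, as in the Kronecker product. *)
Definition qubit_bit (M : nat) (j : 'I_(2 ^ M)) (k : 'I_M) : bool :=
  odd (j %/ 2 ^ (M - k.+1)).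

(* The tensor factor at position k is moved to position s k: the basis vector
   |b> is sent to |a>, where a_(s k) = b_k for all k. *)
Definition qubit_perm_mx (C : numClosedFieldType) (M : nat) (s : 'S_M) :
    'M[C]_(2 ^ M) :=
  \matrix_(a, b) [forall k, qubit_bit a (s k) == qubit_bit b k]%:R.

Definition orthonormal_pair (C : numClosedFieldType) (n : nat)
    (u v : 'cV[C]_n) : Prop :=
  [/\ u ^t* *m u = 1%:M, v ^t* *m v = 1%:M & u ^t* *m v = 0].

Definition cliffords_by_qubit_permutations (C : numClosedFieldType) (M : nat) :
    Prop :=
  exists u v : 'cV[C]_(2 ^ M), orthonormal_pair u v /\
    forall G : 'M[C]_2, clifford_gate G ->
      exists (s : 'S_M) (z : C),
        [/\ `|z| = 1,
            qubit_perm_mx C s *m u = z *: (G 0 0 *: u + G 1 0 *: v) &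
            qubit_perm_mx C s *m v = z *: (G 0 1 *: u + G 1 1 *: v)].

(* Main.v *)
Require Import Defs.
From mathcomp Require Import all_boot all_order all_algebra.
From mathcomp Require Import all_fingroup.
From mathcomp Require Import complex reals.

Set Implicit Arguments.
Unset Strict Implicit.
Unset Printing Implicit Defensive.

Import Order.TTheory GRing.Theory Num.Theory.
Local Open Scope ring_scope.

(* If P and H implement the phase and Hadamard gates on the logical states u, v
   up to the phases z1 and z2, the stacked column (u, v) lies in the right
   kernel of (A, A'); since u has norm one it is nonzero, so (A, A') does not
   have full column rank. *)

(** By induction on the number of digits: digit 0 is the parity, and halving shifts the remaining
    digits down by one. *)
Lemma eq_binary_digits (n i j : nat) :
  (i < 2 ^ n)%N -> (j < 2 ^ n)%N ->
  (forall m, (m < n)%N -> odd (i %/ 2 ^ m) = odd (j %/ 2 ^ m)) -> i = j.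
Proof.
elim: n i j => [|n IHn] i j; first by rewrite expn0 !ltnS !leqn0 => /eqP-> /eqP->.
rewrite expnS mul2n => lt_i lt_j eq_ij.
rewrite -(odd_double_half i) -(odd_double_half j).
have := eq_ij 0%N isT; rewrite expn0 !divn1 => ->; congr (_ + _.*2)%N.
apply: IHn; rewrite ?ltn_half_double // => m lt_mn.
by rewrite -!divn2 -!divnMA -expnS; apply: eq_ij.
Qed.

Definition qubit_bits (M : nat) (j : 'I_(2 ^ M)) : {ffun 'I_M -> bool} :=
  [ffun k => qubit_bit j k].

Lemma qubit_bits_inj (M : nat) : injective (@qubit_bits M).
Proof.
move=> i j eq_ij; apply/val_inj/(@eq_binary_digits M) => //= m lt_mM.
(* Qubit 0 is the most significant, so the digit of weight [2 ^ m] sits on qubit [M - m.+1]. *)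
have lt_kM : (M - m.+1 < M)%N by rewrite ltn_subrL; case: M lt_mM {i j eq_ij}.
have := congr1 (fun f : {ffun 'I_M -> bool} => f (Ordinal lt_kM)) eq_ij.
by rewrite !ffunE /qubit_bit /= subnSK // subKn // ltnW.
Qed.

Lemma qubit_bits_bij (M : nat) : bijective (@qubit_bits M).
Proof.
apply: inj_card_bij; first exact: qubit_bits_inj.
by rewrite card_ffun card_bool !card_ord.
Qed.

Lemma qubit_perm_mx_is_perm (C : numClosedFieldType) (M : nat) (s : 'S_M) :
  is_perm_mx (qubit_perm_mx C s).
Proof.
have [g bitsK gK] := qubit_bits_bij M.
(* [f a] is the index whose k-th bit is bit [s k] of [a]: the only column with a 1 in row [a]. *)
pose f a := g [ffun k => qubit_bits a (s k)].
have f_inj : injective f.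
  move=> a b /(can_inj gK)/ffunP eq_ab; apply/qubit_bits_inj/ffunP => k.
  by have := eq_ab (s^-1%g k); rewrite !ffunE permKV.
apply/is_perm_mxP; exists (perm f_inj); apply/matrixP => a b.
rewrite !mxE permE; congr (_%:R); congr nat_of_bool.
rewrite -(inj_eq (@qubit_bits_inj M)) gK; apply/forallP/eqP => [ab|/ffunP ab k].
  by apply/ffunP => k; rewrite !ffunE; apply/eqP.
by have := ab k; rewrite !ffunE => ->.
Qed.

(** Full column rank would give a left inverse [B], whence [w = B *m A *m w = 0]. *)
Lemma rank_lt_of_kernel (F : fieldType) (m n : nat) (A : 'M[F]_(m, n))
    (w : 'cV[F]_n) : w != 0 -> A *m w = 0 -> (\rank A < n)%N.
Proof.
move=> w_neq0 Aw0; rewrite ltn_neqAle rank_leq_col andbT.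
by apply: contra w_neq0 => /row_fullP[B BA1]; rewrite -[w]mul1mx -BA1 -mulmxA Aw0 mulmx0.
Qed.

Theorem theorem2 (R : realType) (M : nat) (hM : (0 < M)%N)
    (hcliff : cliffords_by_qubit_permutations R[i] M) :
  exists (P H : 'M[R[i]]_(2 ^ M)) (z1 z2 : R[i]),
    [/\ is_perm_mx P, is_perm_mx H, `|z1| = 1, `|z2| = 1 &
      let A := block_mx (P - z1%:M) 0
                        0           (- 'i *: P - z1%:M) in
      let A' := block_mx (sqrtC 2 *: H - z2%:M) (- z2%:M)
                         (- z2%:M)              (sqrtC 2 *: H + z2%:M) in
      (\rank (col_mx A A') < 2 ^ M.+1)%N].
Proof.
have [u [v [[uu1 _ _] impl]]] := hcliff.
have [s [z1 [z1_1 Pu Pv]]] := impl _ (clifford_phase_gate _).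
have [t [z2 [z2_1 Hu Hv]]] := impl _ (clifford_hadamard _).
exists (qubit_perm_mx _ s), (qubit_perm_mx _ t), z1, z2.
split=> //; try exact: qubit_perm_mx_is_perm.
move: Pu Pv Hu Hv; rewrite !mxE /= => Pu Pv Hu Hv.
have s2_neq0 : sqrtC 2 != 0 :> R[i] by rewrite sqrtC_eq0 pnatr_eq0.
have -> : (2 ^ M.+1 = 2 ^ M + 2 ^ M)%N by rewrite expnS mul2n addnn.
apply: (@rank_lt_of_kernel _ _ _ _ (col_mx u v)).
  rewrite col_mx_eq0 negb_and; apply/orP; left; apply/eqP => u0.
  by move/matrixP/(_ 0 0): uu1; rewrite u0 mulmx0 !mxE => /esym/eqP; rewrite oner_eq0.
rewrite mul_col_mx !mul_block_col !mul0mx addr0 add0r.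
rewrite !mulmxDl !mulNmx -!scalemxAl !mul_scalar_mx Pu Pv Hu Hv.
rewrite !scale0r addr0 add0r scale1r subrr.
(* The lower block of [A] vanishes on [v] because the phase gate multiplies [v] by [z1 * 'i] and
   [- 'i * 'i = 1]. *)
rewrite !scalerA mulrCA mulNr -expr2 sqrCi opprK mulr1 subrr.
rewrite mulr1 mulrN1 scaleNr scalerBr !scalerDr !scalerA.
(* The factor [sqrtC 2] clears the Hadamard normalisation: the images of [u] and [v] become
   [z2 *: (u + v)] and [z2 *: (u - v)], which the remaining terms of [A'] cancel. *)
rewrite (mulrAC _ z2) divff // mul1r subrK addNr (addrAC (z2 *: u)) subrr add0r.
by rewrite subrr !col_mx0.
Qed.
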